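(* Let $\mathrm{ARB}_n\subseteq\{0,1\}^{A_n}$ be the set of characteristic vectors of spanning arborescences in the complete directed graph on $n$ nodes (arc set $A_n$), and let $\mathrm{SPT}_n\subseteq\{0,1\}^{E_n}$ be the set of characteristic vectors of spanning trees in the complete undirected graph $K_n=(V_n,E_n)$. Then $\mathrm{rc}(\mathrm{ARB}_n)=2^{\Theta(n)}$ and $\mathrm{rc}(\mathrm{SPT}_n)=2^{\Theta(n)}$.
   Context: For $X\subseteq\mathbb{Z}^d$, a polyhedron $R\subseteq\mathbb{R}^d$ is called a relaxation for $X$ if $R\cap\mathbb{Z}^d=\mathrm{conv}(X)\cap\mathbb{Z}^d$. The relaxation complexity $\mathrm{rc}(X)$ is the smallest number of facets of any relaxation for $X$. A spanning arborescence is an arc set forming a directed spanning tree in which every node except one (the root, which may be any node) has exactly one incoming arc and all arcs are directed away from the root. The notation $f(n)=2^{\Theta(n)}$ means there exist constants $c_1,c_2>0$ with $2^{c_1n}\le f(n)\le 2^{c_2n}$ for all sufficiently large $n$. *)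

(* Defs.v *)
From HB Require Import structures.
From mathcomp Require Import all_boot all_order all_algebra.
From mathcomp Require Import all_classical all_reals all_analysis.
Set Implicit Arguments.
Unset Strict Implicit.
Unset Printing Implicit Defensive.
Import Order.TTheory GRing.Theory Num.Theory.
Local Open Scope classical_set_scope.
Local Open Scope card_scope.
Local Open Scope ring_scope.

Section Polyhedra.
Variables (R : realType) (I : finType).
(* R^I; [R^o] gives the coordinates their R-module structure, so that V is a
   vectType R. *)
Local Notation V := {ffun I -> R^o}.
Implicit Types (S P F : set V) (a x : V).

Definition dotp a x : R := \sum_(i : I) a i * x i.

Definition conv_hull S : set V :=
  [set x | exists m (l : 'I_m -> R) (p : 'I_m -> V),
     [/\ forall i, S (p i), forall i, 0 <= l i, \sum_i l i = 1
       & x = \sum_i l i *: p i]].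

Definition aff_hull S : set V :=
  [set x | exists m (l : 'I_m -> R) (p : 'I_m -> V),
     [/\ forall i, S (p i), \sum_i l i = 1 & x = \sum_i l i *: p i]].

(* In particular the empty set has no dimension. *)
Definition has_dim S (k : nat) : Prop :=
  exists x0 (U : {vspace V}),
    aff_hull S = [set x0 + u | u in [set u | u \in U]] /\ \dim U = k.

Definition polyhedron P : Prop :=
  exists m (a : 'I_m -> V) (b : 'I_m -> R),
    P = [set x | forall i, dotp (a i) x <= b i].

Definition face P F : Prop :=
  exists a (b : R), (forall x, P x -> dotp a x <= b) /\
    F = P `&` [set x | dotp a x = b].

Definition facet P F : Prop :=
  face P F /\ exists k, has_dim F k /\ has_dim P k.+1.

Definition has_facets P (k : nat) : Prop := [set F | facet P F] #= `I_k.

Definition lattice_pt (z : {ffun I -> int}) : V := [ffun i => (z i)%:~R].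

Definition lattice : set V := range lattice_pt.

Definition relaxation (X : set {ffun I -> int}) P : Prop :=
  polyhedron P /\ P `&` lattice = conv_hull (lattice_pt @` X) `&` lattice.

(* The value is +oo when X admits no relaxation; otherwise it is the infimum of
   a nonempty set of naturals, hence a minimum. *)
Definition rc (X : set {ffun I -> int}) : \bar R :=
  ereal_inf [set k%:R%:E | k in
    [set k : nat | exists P, relaxation X P /\ has_facets P k]].

End Polyhedra.

Arguments rc R {I} X.

Definition two_pow_Theta (R : realType) (f : nat -> \bar R) : Prop :=
  exists c1 c2 : R, [/\ 0 < c1, 0 < c2 &
    \forall n \near \oo,
      ((2 `^ (c1 * n%:R))%:E <= f n <= (2 `^ (c2 * n%:R))%:E)%E].

Definition char_vec (I : finType) (T : {set I}) : {ffun I -> int} :=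
  [ffun i => (i \in T)%:R].

Section Graphs.
Variable n : nat.

Definition edgeT := {e : {set 'I_n} | #|e| == 2}.
Definition arcT := {a : 'I_n * 'I_n | a.1 != a.2}.

Definition adj (T : {set edgeT}) : rel 'I_n :=
  fun u v => [exists e in T, val e == [set u; v]%SET].

Definition connected_graph (T : {set edgeT}) : Prop :=
  forall u v, connect (adj T) u v.

Definition acyclic (T : {set edgeT}) : Prop :=
  forall p : seq 'I_n, (2 < size p)%N -> ~ ucycle (adj T) p.

Definition spanning_tree (T : {set edgeT}) : Prop :=
  connected_graph T /\ acyclic T.

Definition underlying (T : {set arcT}) : {set edgeT} :=
  [set e : edgeT | [exists a in T, val e == [set (val a).1; (val a).2]%SET]]%SET.

Definition darc (T : {set arcT}) : rel 'I_n :=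
  fun u v => [exists a in T, val a == (u, v)].

Definition indeg (T : {set arcT}) (v : 'I_n) : nat :=
  #|[set a in T | (val a).2 == v]%SET|.

(* All arcs of the tree point away from r: every node is reached from r along
   directed arcs and no arcT enters r. *)
Definition spanning_arborescence (T : {set arcT}) : Prop :=
  spanning_tree (underlying T) /\
  exists r : 'I_n,
    [/\ indeg T r = 0%N, forall v, v != r -> indeg T v = 1%N
      & forall v, connect (darc T) r v].

Definition SPT : set {ffun edgeT -> int} :=
  [set char_vec T | T in [set T | spanning_tree T]].

Definition ARB : set {ffun arcT -> int} :=
  [set char_vec T | T in [set T | spanning_arborescence T]].

End Graphs.

Arguments SPT n : clear implicits.
Arguments ARB n : clear implicits.

(* Main.v *)
(** A hiding set bounds the relaxation complexity from below: integer points of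
    the affine hull of [X] outside [conv X], any two of which have a midpoint in
    [conv X], violate pairwise distinct facets of every relaxation.

    Both families of trees consist of the incidence vectors of the sets of
    [n - 1] edges (arcs) along which some root reaches every node.  Requiring an
    edge to enter one of any two disjoint nonempty node sets cuts out these
    vectors, with at most [4 ^ n] such inequalities.

    The hiding set consists of disconnected parent maps: a cycle on a node set
    [S], all nodes outside [S] being children of a fixed node.  If the cycles on
    [S] and [S'] enter a common node [y] from [S \ S'] and from [S' \ S],
    exchanging the two parents of [y] turns both maps into trees without changing
    their sum.  There are exponentially many such sets [S], pairwise related in
    this way. *)

Require Import Defs.
From HB Require Import structures.
From mathcomp Require Import all_boot all_order all_algebra.
From mathcomp Require Import all_classical all_reals all_analysis.
From mathcomp Require Import zify ring lra.

Set Implicit Arguments.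
Unset Strict Implicit.
Unset Printing Implicit Defensive.
Import Order.TTheory GRing.Theory Num.Theory.
Local Open Scope classical_set_scope.
Local Open Scope card_scope.
Local Open Scope ring_scope.

Lemma card_setT_fin (B : finType) : [set: B] #= `I_#|B|.
Proof.
have rinj : {in [set: B] &, injective (fun j : B => val (enum_rank j))}.
  by move=> i j _ _ /val_inj /enum_rank_inj.
suff -> : `I_#|B| = (fun j : B => val (enum_rank j)) @` [set: B].
  by rewrite card_eq_sym inj_card_eq.
apply/seteqP; split=> [i /= iJ|_ [j _ <-] /=]; last exact: ltn_ord.
by exists (enum_val (Ordinal iJ)) => //; rewrite enum_valK.
Qed.

(** * Facets of polyhedra *)

Section Polyhedra.
Variables (R : realType) (I : finType).
Local Notation V := {ffun I -> R^o}.
Implicit Types (a x y z u : V) (b t : R) (S P F : set V) (U W : {vspace V}).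

(** Typed into [R^o], so that it can be declared linear and its kernel taken as a subspace. *)
Definition dotl a : V -> R^o := dotp a.

Lemma dotl_is_linear a : linear (dotl a).
Proof.
move=> t x y; rewrite /dotl /dotp scaler_sumr -big_split /=.
by apply: eq_bigr => i _; rewrite !ffunE mulrDr mulrCA.
Qed.

HB.instance Definition _ a :=
  GRing.isLinear.Build R V R^o _ (dotl a) (dotl_is_linear a).

Lemma dotpD a x y : dotp a (x + y) = dotp a x + dotp a y.
Proof. exact: (raddfD (dotl a)). Qed.

Lemma dotpB a x y : dotp a (x - y) = dotp a x - dotp a y.
Proof. exact: (raddfB (dotl a)). Qed.

Lemma dotpZ a t x : dotp a (t *: x) = t * dotp a x.
Proof. exact: (linearZ_LR (dotl a)). Qed.

Lemma dotp_sum a m (p : 'I_m -> V) :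
  dotp a (\sum_i p i) = \sum_i dotp a (p i).
Proof. exact: (raddf_sum (dotl a)). Qed.

Lemma memv_lker_dotl a u : (u \in lker (linfun (dotl a))) = (dotp a u == 0).
Proof. by rewrite memv_ker lfunE. Qed.

(** Rank-nullity: the functional does not vanish on [U], so its image is a line. *)
Lemma dim_cap_lker_dotl a U u : u \in U -> dotp a u != 0 ->
  \dim U = (\dim (U :&: lker (linfun (dotl a)))).+1.
Proof.
move=> uU au; rewrite -[LHS](limg_ker_dim (linfun (dotl a))).
rewrite addnC -add1n; congr addn.
apply/eqP; rewrite eqn_leq; apply/andP; split.
  apply: (leq_trans (dimvS (subvf _))).
  by rewrite dimvf.
rewrite lt0n dimv_eq0; apply/negP => /eqP H0.
have: linfun (dotl a) u \in (linfun (dotl a) @: U)%VS by exact: memv_img.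
by rewrite H0 memv0 lfunE /= /dotl (negbTE au).
Qed.

(** * Convex and affine hulls *)

Lemma sub_conv_hull S : S `<=` conv_hull S.
Proof.
move=> x Sx; exists 1%N, (fun=> 1), (fun=> x); split=> //.
  by rewrite big_ord1.
by rewrite big_ord1 scale1r.
Qed.

Lemma conv_hull_sub_aff S : conv_hull S `<=` aff_hull S.
Proof. by move=> x [m [l [p [Sp _ l1 ->]]]]; exists m, l, p. Qed.

Lemma sub_aff_hull S : S `<=` aff_hull S.
Proof. by move=> x /sub_conv_hull/conv_hull_sub_aff. Qed.

Lemma aff_hullS S P : S `<=` P -> aff_hull S `<=` aff_hull P.
Proof.
by move=> SP x [m [l [p [Sp l1 ->]]]]; exists m, l, p; split=> // i; exact: SP.
Qed.

Lemma aff_hull_nonempty S x : aff_hull S x -> S !=set0.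
Proof.
move=> [[|m] [l [p [Sp l1 _]]]]; last by exists (p ord0).
by move/eqP: l1; rewrite big_ord0 eq_sym oner_eq0.
Qed.

Lemma dotp_aff_hull S a b x :
  (forall y, S y -> dotp a y = b) -> aff_hull S x -> dotp a x = b.
Proof.
move=> H [m [l [p [Sp l1 ->]]]]; rewrite dotp_sum.
rewrite (eq_bigr (fun i => l i * b)); last by move=> i _; rewrite dotpZ H.
by rewrite -mulr_suml l1 mul1r.
Qed.

Lemma dotp_conv_hull S a b x :
  (forall y, S y -> dotp a y <= b) -> conv_hull S x -> dotp a x <= b.
Proof.
move=> H [m [l [p [Sp l0 l1 ->]]]]; rewrite dotp_sum -[b]mul1r -l1 mulr_suml.
by apply: ler_sum => i _; rewrite dotpZ; apply: ler_wpM2l; rewrite ?H.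
Qed.

(* [x0 + U] is the affine hull of [S] as soon as it contains [S] and [x0] is a
   point of [S] interior relative to it. *)
Lemma aff_hull_interior S x0 U : S x0 ->
  (forall x, S x -> x - x0 \in U) ->
  (forall u, u \in U -> exists2 t, 0 < t & S (x0 + t *: u)) ->
  aff_hull S = [set x0 + u | u in [set u | u \in U]].
Proof.
move=> Sx0 SU US; apply/seteqP; split=> [x [m [l [p [Sp l1 ->]]]]|x [u /= uU <-]].
  exists (\sum_i l i *: (p i - x0)) => /=.
    by apply: memv_suml => i _; apply/memvZ/SU.
  rewrite (eq_bigr (fun i => l i *: p i - l i *: x0)); last first.
    by move=> i _; rewrite scalerBr.
  by rewrite sumrB -scaler_suml l1 scale1r addrC subrK.
have [t t0 St] := US u uU.
exists 2%N, (fun i => if i == ord0 then 1 - t^-1 else t^-1),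
  (fun i => if i == ord0 then x0 else x0 + t *: u); split.
- by move=> i; case: ifP.
- by rewrite big_ord_recl big_ord1 /= subrK.
- rewrite big_ord_recl big_ord1 /= scalerBl scale1r scalerDr scalerA mulVf ?gt_eqF//.
  by rewrite scale1r addrA subrK.
Qed.

Lemma aff_hull_dir S x0 U x y : 
  aff_hull S = [set x0 + u | u in [set u | u \in U]] ->
  aff_hull S x -> aff_hull S y -> y - x \in U.
Proof.
move=> -> [u /= uU <-] [v /= vU <-].
by rewrite opprD addrACA subrr add0r rpredB.
Qed.

Lemma aff_hull_shift S x0 U x u :
  aff_hull S = [set x0 + u | u in [set u | u \in U]] ->
  aff_hull S x -> u \in U -> aff_hull S (x + u).
Proof.
move=> -> [v /= vU <-] uU; exists (v + u); last by rewrite addrA.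
by rewrite /= rpredD.
Qed.

Lemma aff_hull_dir_sub S P x0 x1 U W :
  S `<=` P ->
  aff_hull S = [set x0 + u | u in [set u | u \in U]] ->
  aff_hull P = [set x1 + u | u in [set u | u \in W]] ->
  (U <= W)%VS.
Proof.
move=> SP HU HW; apply/subvP => u uU.
have A0 : aff_hull S x0 by rewrite HU; exists 0; rewrite ?addr0//= mem0v.
have A1 := aff_hull_shift HU A0 uU.
have := aff_hull_dir HW (aff_hullS SP A0) (aff_hullS SP A1).
by rewrite addrC addKr.
Qed.

(** * Systems of linear inequalities *)

Section System.
Variables (J : finType) (a : J -> V) (b : J -> R).

Definition poly_of (D : {pred J}) : set V :=
  [set x | forall j, j \in D -> dotp (a j) x <= b j].

Definition tight S j := forall x, S x -> dotp (a j) x = b j.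

Lemma relint_point S :
  (forall x y, S x -> S y -> S (2^-1 *: x + 2^-1 *: y)) ->
  S !=set0 -> (forall j x, S x -> dotp (a j) x <= b j) ->
  exists2 x, S x & forall j, tight S j \/ dotp (a j) x < b j.
Proof.
move=> mid [x0 Sx0] Sle.
suff H (s : seq J) : exists2 x, S x & forall j, j \in s ->
    tight S j \/ dotp (a j) x < b j.
  by have [x Sx Hx] := H (enum J); exists x => // j; apply: Hx; rewrite mem_enum.
elim: s => [|j s [x Sx IH]]; first by exists x0.
have [tj|/existsNP[y /not_implyP[Sy yb]]] := pselect (tight S j).
  by exists x => // k; rewrite inE => /orP[/eqP->|/IH]; [left|].
have {}yb : dotp (a j) y < b j by rewrite lt_neqAle Sle // andbT; apply/eqP.
exists (2^-1 *: x + 2^-1 *: y); first exact: mid.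
move=> k; rewrite inE dotpD !dotpZ => /orP[/eqP->|/IH[|xk]].
- by right; have := Sle j x Sx; lra.
- by left.
- by right; have := Sle k y Sy; lra.
Qed.

Lemma small_step x u : exists2 t, 0 < t &
  forall j, dotp (a j) x < b j -> dotp (a j) (x + t *: u) <= b j.
Proof.
(* Covering all shorter steps as well lets the induction take a minimum. *)
suff H (s : seq J) : exists2 t, 0 < t & forall j, j \in s ->
    dotp (a j) x < b j -> forall r, 0 < r <= t -> dotp (a j) (x + r *: u) <= b j.
  have [t t0 Ht] := H (enum J); exists t => // j xj; apply: Ht => //.
    by rewrite mem_enum.
  by rewrite t0 lexx.
elim: s => [|j s [t t0 IH]]; first by exists 1.
pose d := `|dotp (a j) u| + 1.
have d0 : 0 < d by rewrite /d ltr_wpDl.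
have [xj|xj] := ltP (dotp (a j) x) (b j); last first.
  exists t => // k; rewrite inE => /orP[/eqP->|/IH//].
  by rewrite ltNge xj.
exists (Num.min t ((b j - dotp (a j) x) / d)).
  by rewrite lt_min t0 divr_gt0 // subr_gt0.
move=> k ks xk r; rewrite le_min => /and3P[r0 rt rd].
move: ks xk; rewrite inE => /orP[/eqP->|ks] xk; last by apply: IH; rewrite ?r0.
rewrite dotpD dotpZ -lerBrDl.
move: rd; rewrite ler_pdivlMr // => rd; apply: le_trans rd.
rewrite ler_pM2l // /d; apply: le_trans (ler_norm _) _.
by rewrite lerDl.
Qed.

End System.

(** Each facet is the part of [P] where some inequality, tight on the facet but not on [P], holds
    with equality. So there are at most as many facets as inequalities. *)
Lemma has_facets_le (J : finType) (a : J -> V) (b : J -> R) P :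
  P = [set x | forall j, dotp (a j) x <= b j] ->
  exists2 k, has_facets P k & (k <= #|J|)%N.
Proof.
move=> EP.
have Pmid x y t : P x -> P y -> 0 <= t <= 1 -> P ((1 - t) *: x + t *: y).
  rewrite EP => /= Px Py t01 j; rewrite dotpD !dotpZ.
  have := Px j; have := Py j; nra.
have sub : [set F | facet P F] `<=`
    [set P `&` [set x | dotp (a j) x = b j] | j in [set: J]].
  move=> F [[c [d [Pc EF]]] [k [[x0 [U [HU dU]]] [x1 [W [HW dW]]]]]].
  have FP : F `<=` P by rewrite EF => x [].
  have Fne : F !=set0.
    by apply: (@aff_hull_nonempty F x0); rewrite HU; exists 0;
       rewrite ?addr0//= mem0v.
  have Fmid x y : F x -> F y -> F (2^-1 *: x + 2^-1 *: y).
    rewrite EF => -[Px /= xd] [Py /= yd]; split; last first.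
      by rewrite /= dotpD !dotpZ xd yd; lra.
    have := @Pmid x y 2^-1 Px Py.
    have -> : 1 - 2^-1 = 2^-1 :> R by lra.
    by apply; lra.
  have Fle j x : F x -> dotp (a j) x <= b j by move/FP; rewrite EP; exact.
  have [x Fx Hx] := relint_point Fmid Fne Fle.
  (* Otherwise [F = P], against the dimensions. *)
  have [j [tF ntP]] : exists j, tight a b F j /\ ~ tight a b P j.
    apply: contrapT => /forallNP allT.
    have FPT j : tight a b F j -> tight a b P j.
      by move=> tF; apply: contrapT => ?; apply: (allT j).
    suff : F = P.
      move=> FPe; have := aff_hull_dir_sub FP HU HW.
      have PF : P `<=` F by rewrite FPe.
      have := aff_hull_dir_sub PF HW HU => /dimvS + /dimvS.
      by rewrite dU dW ltnn.
    apply/seteqP; split=> // y Py.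
    apply: contrapT => nFy.
    have cy : dotp c y < d.
      rewrite lt_neqAle Pc // andbT; apply/eqP => cy; apply: nFy.
      by rewrite EF.
    (* The segment from [y] can be prolonged within [P] beyond the relative interior point [x] of
       [F]; there [dotp c] exceeds its bound [d]. *)
    have [t t0 Ht] := small_step a b x (x - y).
    have Pz : P (x + t *: (x - y)).
      rewrite EP /= => j; have [tj|] := Hx j; last exact: Ht.
      have tPj := FPT j tj.
      by rewrite dotpD dotpZ dotpB tPj ?tPj//; [lra | exact: FP].
    have := Pc _ Pz.
    have cx : dotp c x = d by move: Fx; rewrite EF => -[].
    rewrite dotpD dotpZ dotpB cx; nra.
  exists j => //; apply/seteqP; split; last by move=> y Fy; split; [exact: FP|exact: tF].
  move=> y [Py /= yj].
  (* [K] contains the directions [U] of [F] and has dimension at most [k], so the two agree. Points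
     of [P] with equality in [j] thus lie in the affine hull of [F]. *)
  set K := (W :&: lker (linfun (dotl (a j))))%VS.
  have UW := aff_hull_dir_sub FP HU HW.
  have UK : (U <= K)%VS.
    apply/subvP => u uU; rewrite memv_cap (subvP UW) //= memv_lker_dotl.
    have xu : aff_hull F (x + u).
      exact: (aff_hull_shift HU (sub_aff_hull Fx) uU).
    have := dotp_aff_hull tF xu.
    by rewrite dotpD (tF x Fx) => /eqP; rewrite -subr_eq0 addrC addKr.
  have dK : (\dim K <= k)%N.
    move/existsNP: ntP => [z /not_implyP[Pz zj]].
    have zW : z - x \in W.
      by apply: (aff_hull_dir HW); apply: sub_aff_hull => //; exact: FP.
    have az : dotp (a j) (z - x) != 0.
      by rewrite dotpB (tF x Fx) subr_eq0; apply/eqP.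
    by have := dim_cap_lker_dotl zW az; rewrite dW -/K => -[<-].
  have EK : U = K by apply/eqP; rewrite eqEdim UK dU.
  have yU : y - x \in U.
    rewrite EK memv_cap memv_lker_dotl dotpB yj (tF x Fx) subrr eqxx andbT.
    by apply: (aff_hull_dir HW); apply: sub_aff_hull => //; exact: FP.
  have ya : aff_hull F y.
    rewrite -[y](subrK x) addrC.
    exact: (aff_hull_shift HU (sub_aff_hull Fx) yU).
  rewrite EF; split=> //=; apply: dotp_aff_hull ya => z.
  by rewrite EF => -[].
have cardJ : [set F | facet P F] #<= `I_#|J|.
  apply: card_le_trans (subset_card_le sub) _.
  apply: card_le_trans (card_image_le _ _) _.
  by rewrite (card_le_eql (card_setT_fin J)).
have [k Hk] : exists k, [set F | facet P F] #= `I_k.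
  apply/finite_setP; apply: card_le_finite cardJ _.
  exact: finite_II.
exists k => //.
by move: cardJ; rewrite (card_le_eql Hk) card_le_II.
Qed.

Lemma polyhedron_fin (J : finType) (a : J -> V) (b : J -> R) :
  polyhedron [set x | forall j, dotp (a j) x <= b j].
Proof.
exists #|J|, (fun i => a (enum_val i)), (fun i => b (enum_val i)).
apply/seteqP; split=> x /= H j; first exact: H.
by have := H (enum_rank j); rewrite enum_rankK.
Qed.

(* With an inclusion-minimal system describing [P] inside its affine hull, each
   inequality defines its own facet; each point outside [P] violates one of
   them, and no inequality is violated by two points whose connecting segment
   meets [P]. *)
Lemma hiding_has_facets (B : finType) (h : B -> V) P k :
  polyhedron P -> has_facets P k ->
  P !=set0 -> (forall i, aff_hull P (h i)) -> (forall i, ~ P (h i)) ->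
  (forall i j, i != j -> P (2^-1 *: h i + 2^-1 *: h j)) ->
  (#|B| <= k)%N.
Proof.
move=> [m [a [b EP]]] Pk Pne hA hP hh.
have Ple j x : P x -> dotp (a j) x <= b j by rewrite EP; exact.
have Pmid x y : P x -> P y -> P (2^-1 *: x + 2^-1 *: y).
  rewrite EP => /= Px Py j; rewrite dotpD !dotpZ.
  by have := Px j; have := Py j; lra.
have [x0 Px0 Hx0] := relint_point Pmid Pne Ple.
(* The solutions of the homogeneous implicit equations of [P]. *)
pose U := (\bigcap_(j | `[< tight a b P j >]) lker (linfun (dotl (a j))))%VS.
have memU u : reflect (forall j, tight a b P j -> dotp (a j) u = 0) (u \in U).
  apply: (iffP idP) => [uU j tj|H].
    apply/eqP; rewrite -memv_lker_dotl; apply: (subvP _ _ uU).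
    by apply: bigcapv_inf (subvv _); apply/asboolP.
  rewrite memvE; apply/subv_bigcapP => j /asboolP tj.
  by rewrite -memvE memv_lker_dotl H.
have affP : aff_hull P = [set x0 + u | u in [set u | u \in U]].
  apply: aff_hull_interior => // [x Px|u /memU uU].
    by apply/memU => j tj; rewrite dotpB !tj ?subrr.
  have [t t0 Ht] := small_step a b x0 u.
  exists t => //; rewrite EP /= => j; have [tj|/Ht//] := Hx0 j.
  by rewrite dotpD dotpZ uU // mulr0 addr0; exact: Ple.
(* Within [x0 + U], the inequalities in [D] suffice to describe [P]. *)
pose Q (D : {set 'I_m}) : bool :=
  `[< forall x, x - x0 \in U -> poly_of a b D x -> P x >].
have QT : Q [set: 'I_m]%SET.
  by apply/asboolP => x _ H; rewrite EP => j; apply: H.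
have [D Dmin _] := minset_exists QT.
have /asboolP QD : Q D := minsetp Dmin.
(* By minimality, dropping [j] admits a point outside [P], which violates only [j] among [D]. *)
have wit j : j \in D -> exists y, [/\ y - x0 \in U, b j < dotp (a j) y &
    forall i, i \in D -> i != j -> dotp (a i) y <= b i].
  move=> jD.
  have : ~~ Q (D :\ j)%SET.
    apply/negP => QDj; have := minsetinf Dmin QDj (subD1set _ _).
    by move/setP/(_ j); rewrite jD !inE eqxx.
  move=> /asboolP/existsNP[y /not_implyP[yU /not_implyP[yD nPy]]].
  have yi i : i \in D -> i != j -> dotp (a i) y <= b i.
    by move=> iD ij; apply: yD; rewrite !inE ij.
  exists y; split=> //; rewrite ltNge; apply/negP => yj; apply: nPy.
  by apply: QD => // i iD; have [->//|] := eqVneq i j; exact: yi.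
have strict j : j \in D -> dotp (a j) x0 < b j.
  move=> jD; have [tj|//] := Hx0 j.
  have [y [/memU/(_ j tj)]] := wit j jD.
  by rewrite dotpB (tj x0 Px0); lra.
(* The segment from [x0] to [y] meets the hyperplane of [j] at a point strict in all other
   inequalities of [D]: a relative interior point of the facet. *)
have wit2 j : j \in D -> exists z, [/\ z - x0 \in U, dotp (a j) z = b j &
    forall i, i \in D -> i != j -> dotp (a i) z < b i].
  move=> jD; have [y [yU yj yi]] := wit j jD.
  have sj := strict j jD.
  pose t := (b j - dotp (a j) x0) / (dotp (a j) y - dotp (a j) x0).
  have E : t * (dotp (a j) y - dotp (a j) x0) = b j - dotp (a j) x0.
    by rewrite /t divfK // subr_eq0 gt_eqF // (lt_trans sj).
  have t0 : 0 < t by nra.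
  have t1 : t < 1 by nra.
  exists (x0 + t *: (y - x0)); split.
  - by rewrite addrC addKr memvZ.
  - by rewrite dotpD dotpZ dotpB E addrC subrK.
  - move=> i iD ij; have := yi i iD ij; have := strict i iD.
    rewrite dotpD dotpZ dotpB; nra.
pose G j := P `&` [set x | dotp (a j) x = b j].
have facetG j : j \in D -> facet P (G j).
  move=> jD; have [z [zU zj zi]] := wit2 j jD.
  split; first by exists (a j), (b j); split=> // x /Ple.
  have Pz : P z.
    by apply: QD => // i iD; have [->|/zi/ltW->//] := eqVneq i j; rewrite zj.
  exists (\dim (U :&: lker (linfun (dotl (a j))))); split; last first.
    exists x0, U; split=> //; apply: dim_cap_lker_dotl zU _.
    by rewrite dotpB zj subr_eq0 gt_eqF // strict.
  exists z, (U :&: lker (linfun (dotl (a j))))%VS; split=> //.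
  apply: aff_hull_interior; first by split.
    move=> x [Px xj]; rewrite memv_cap memv_lker_dotl dotpB zj xj subrr eqxx andbT.
    by apply: (aff_hull_dir affP); exact: sub_aff_hull.
  move=> u; rewrite memv_cap memv_lker_dotl => /andP[uU /eqP uj].
  have [t t0 Ht] := small_step a b z u.
  exists t => //; split; last by rewrite /= dotpD dotpZ uj mulr0 addr0.
  apply: QD.
    by rewrite addrAC memvD // memvZ.
  move=> i iD; have [->|/(zi _ iD)/Ht//] := eqVneq i j.
  by rewrite dotpD dotpZ uj mulr0 addr0 zj.
have Ginj i j : i \in D -> j \in D -> G i = G j -> i = j.
  move=> iD jD Gij; have [z [zU zj zi]] := wit2 j jD.
  have Pz : P z.
    by apply: QD => // l lD; have [->|/zi/ltW->//] := eqVneq l j; rewrite zj.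
  have : G i z by rewrite Gij; split.
  move=> [_ /= zib]; apply/eqP; apply/negP => ij.
  by have := zi i iD; rewrite zib ltxx => /(_ (introN idP ij)).
have viol i : exists j, j \in D /\ b j < dotp (a j) (h i).
  apply: contrapT => /forallNP H; apply: (hP i); apply: QD.
    by apply: (aff_hull_dir affP); [exact: sub_aff_hull|exact: hA].
  by move=> j jD; rewrite leNgt; apply/negP => ?; apply: (H j).
have [f Hf] := choice viol.
(* If two points violated the same inequality, so would their midpoint. *)
have finj : injective f.
  move=> i i' ff; apply/eqP; apply: contrapT => /negP ii'.
  have := Ple (f i) _ (hh i i' ii').
  have [_ h1] := Hf i; have [_ h2] := Hf i'.
  by move: h2; rewrite -ff dotpD !dotpZ; lra.
have Hinj : {in [set: B] &, injective (G \o f)}.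
  move=> i i' _ _ /= /Ginj E; apply: finj; apply: E; [exact: (Hf i).1|exact: (Hf i').1].
rewrite -card_le_II -(card_le_eqr Pk).
rewrite -(card_le_eql (card_setT_fin B)) -(card_le_eql (inj_card_eq Hinj)).
apply: subset_card_le => _ [i _ <-] /=; apply: facetG; exact: (Hf i).1.
Qed.

End Polyhedra.

(** * Trees as rooted edge sets *)

Lemma connect_exit (vT : finType) (e : rel vT) (A : {pred vT}) x y :
  connect e x y -> x \in A -> y \notin A ->
  exists u v, [/\ u \in A, v \notin A & e u v].
Proof.
move=> /connectP[s]; elim: s x => [|z s IH] x /= => [_ -> -> //|].
move=> /andP[xz sz] yE xA yA; have [zA|zA] := boolP (z \in A).
  exact: IH sz yE zA yA.
by exists x, z.
Qed.

(* [inc i u v] means that [i] can be traversed from [u] to [v]: one way only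
   for an arc, both ways for an edge. *)
Section Incidence.
Import mathcomp.boot.fintype mathcomp.boot.finset.
Local Close Scope classical_set_scope.
Variables (vT I : finType) (inc : I -> rel vT).
Implicit Types (T : {set I}) (S : {set vT}) (u v w : vT) (z : I -> int).

Definition inc_adj T : rel vT := fun u v => [exists i in T, inc i u v].

Definition rooted T : Prop := exists r, forall v, connect (inc_adj T) r v.

Definition rooted_trees : classical_sets.set {ffun I -> int} :=
  [set char_vec T | T in [set T | rooted T /\ #|T|.+1 = #|vT|]]%classic.

Definition entering S : {set I} :=
  [set i | [exists u, exists v, [&& u \notin S, v \in S & inc i u v]]]%SET.

(** Common features of the complete graph and digraph, so that both are treated at once; the last
    clause lets an edge be traversed both ways. *)
Definition complete_incidence : Prop :=
  [/\ forall i u v, inc i u v -> u != v,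
      forall u v, u != v -> exists i, forall j, inc j u v = (j == i)
    & forall i u v u' v', inc i u v -> inc i u' v' ->
        (u' = u /\ v' = v) \/ (u' = v /\ v' = u)].

Lemma inc_adjS T T' : T \subset T' -> subrel (inc_adj T) (inc_adj T').
Proof.
move=> /subsetP TT u v /existsP[i /andP[iT uv]]; apply/existsP; exists i.
by rewrite TT.
Qed.

(* If no node reaches all others, take [r] with a largest set of reachable nodes
   and [v] out of its reach: the sets of ancestors of [r] and of [v] are disjoint
   and entered by nothing. *)
Lemma rooted_of_entering (v0 : vT) z :
  (forall S S', S != set0 -> S' != set0 -> [disjoint S & S'] ->
     exists2 i, i \in entering S :|: entering S' & z i != 0) ->
  rooted [set i | z i != 0]%SET.
Proof.
move=> H; set T := [set i | z i != 0]%SET.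
pose reach u := [set v | connect (inc_adj T) u v]%SET.
have [r _ rmax] := @arg_maxnP _ v0 predT (fun u => #|reach u|) isT.
exists r => v; apply/negPn/negP => rv.
pose anc v := [set u | connect (inc_adj T) u v]%SET.
have anc_ne w : anc w != set0 by apply/set0Pn; exists w; rewrite inE.
have dis : [disjoint anc r & anc v].
  rewrite -setI_eq0; apply/negPn/negP => /set0Pn[u].
  rewrite !inE => /andP[ur uv].
  have : reach r \proper reach u.
    apply/properP; split; last by exists v; rewrite inE.
    by apply/subsetP => w; rewrite !inE; exact: connect_trans.
  by move/proper_card; rewrite ltnNge => /negP; apply; exact: rmax.
have nent w i : i \in entering (anc w) -> z i = 0.
  rewrite inE => /existsP[u /existsP[x]]; rewrite !inE => /and3P[uw xw ux].
  apply/eqP/negPn/negP => zi; move/negP: uw; apply.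
  apply: connect_trans xw; apply: connect1; apply/existsP; exists i.
  by rewrite inE zi.
have [i + zi] := H _ _ (anc_ne r) (anc_ne v) dis.
by rewrite inE => /orP[] /nent zi0; rewrite zi0 eqxx in zi.
Qed.

(** The root lies outside one of two disjoint sets, and a path from it to that set has to enter
    it. *)
Lemma rooted_entering T S S' : rooted T ->
  S != set0 -> S' != set0 -> [disjoint S & S'] ->
  exists2 i, i \in entering S :|: entering S' & i \in T.
Proof.
move=> [r rT] S0 S0' dis.
suff H D : D != set0 -> r \notin D -> exists2 i, i \in entering D & i \in T.
  have [rS|rS] := boolP (r \in S).
    have [|i iS iT] := H S' S0'; first by rewrite (disjointFr dis).
    by exists i => //; rewrite inE iS orbT.
  by have [i iS iT] := H S S0 rS; exists i => //; rewrite inE iS.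
move=> /set0Pn[v vD] rD.
have := connect_exit (A := [predC D]) (rT v).
rewrite !inE rD vD => /(_ isT isT)[u [w]].
rewrite !inE negbK => -[uD wD /existsP[i /andP[iT uw]]].
exists i => //; rewrite inE; apply/existsP; exists u; apply/existsP; exists w.
by rewrite uD wD.
Qed.

Hypothesis incP : complete_incidence.

(** Grow the tree from the root, always along an edge of [T] that leaves the set of nodes reached so
    far. *)
Lemma rooted_subtree T : rooted T ->
  exists T', [/\ T' \subset T, rooted T' & #|T'|.+1 = #|vT|].
Proof.
have [_ _ inc2] := incP.
move=> [r rT].
(* By the last clause every edge of [T'] ends in [A], so an edge leaving [A] is new. *)
suff H k : (k < #|vT|)%N -> exists (A : {set vT}) (T' : {set I}),
    [/\ #|A| = k.+1, r \in A, T' \subset T & #|T'| = k] /\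
    (forall v, v \in A -> connect (inc_adj T') r v) /\
    (forall i u v, i \in T' -> inc i u v -> v \in A).
  have V0 : (0 < #|vT|)%N by apply/card_gt0P; exists r.
  have [|A [T' [[Ak rA T'T T'k] [conn _]]]] := H #|vT|.-1; first by rewrite prednK.
  rewrite prednK // in Ak.
  exists T'; split=> //; last by rewrite T'k prednK.
  exists r => v; apply: conn.
  have /eqP -> : A == [set: vT]%SET by rewrite eqEcard subsetT cardsT Ak /=.
  by rewrite inE.
elim: k => [_|k IH kV].
  exists [set r]%SET, set0; split; first by rewrite cards1 inE eqxx sub0set cards0.
  by split=> [v|i u v]; rewrite ?in_set0 // in_set1 => /eqP->.
have [A [T' [[Ak rA T'T T'k] [conn incA]]]] := IH (ltnW kV).
have [v vA] : exists v, v \notin A.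
  apply/existsP; rewrite -negb_forall; apply/negP => /forallP allA.
  have : A == [set: vT]%SET by rewrite -subTset; apply/subsetP => v _; exact: allA.
  by move=> /eqP AT; move: kV; rewrite -Ak AT cardsT ltnn.
have [u [w [uA wA /existsP[i /andP[iT uw]]]]] := connect_exit (rT v) rA vA.
have iT' : i \notin T' by apply/negP => /incA /(_ uw); rewrite (negbTE wA).
exists (w |: A)%SET, (i |: T')%SET; split.
  rewrite !cardsU1 wA iT' Ak T'k; split=> //; first by rewrite inE rA orbT.
  by rewrite subUset sub1set iT.
have sub : subrel (connect (inc_adj T')) (connect (inc_adj (i |: T')%SET)).
  by apply: connect_sub => x y xy; apply: connect1; apply: inc_adjS xy; exact: subsetUr.
split=> [x|j x y].
  rewrite !inE => /orP[/eqP->|xA]; last by apply: sub; apply: conn.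
  apply: connect_trans (sub _ _ (conn _ uA)) _; apply: connect1.
  by apply/existsP; exists i; rewrite !inE eqxx.
rewrite !inE => /orP[/eqP->|jT' xy]; last by rewrite (incA _ _ _ jT' xy) orbT.
by move=> /(inc2 _ _ _ _ _ uw)[[_ ->]|[_ ->]]; rewrite ?eqxx ?uA ?orbT.
Qed.

Lemma rooted_card T : rooted T -> (#|vT| <= #|T|.+1)%N.
Proof. by move=> /rooted_subtree[T' [/subset_leq_card ? _ <-]]. Qed.

(** [z] dominates the indicator of its support, and a rooted support has at least [#|vT| - 1]
    elements, which is already the sum of [z]. Hence the two are equal. *)
Lemma rooted_support (z : {ffun I -> int}) : (forall i, 0 <= z i) ->
  \sum_i z i + 1 = #|vT|%:R -> rooted [set i | z i != 0]%SET ->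
  rooted_trees z.
Proof.
set T := [set i | _]%SET => z0 zsum rT.
have ge i : (i \in T)%:R <= z i.
  by rewrite inE; have := z0 i; case: eqP => //= /eqP; lia.
have cT : \sum_i ((i \in T)%:R : int) = #|T|%:R.
  by rewrite -sumr_const [in RHS]big_mkcond /=; apply: eq_bigr => i _; case: ifP.
have le : \sum_i z i <= \sum_i ((i \in T)%:R : int).
  rewrite cT -(lerD2r 1) zsum natr1 ler_nat; exact: rooted_card.
have zT : z = char_vec T.
  apply/ffunP => i; rewrite ffunE; apply/eqP.
  have : \sum_i (z i - (i \in T)%:R) == 0.
    by rewrite eq_le sumrB subr_le0 le subr_ge0; apply: ler_sum => j _; exact: ge.
  rewrite psumr_eq0; last by move=> j _; rewrite subr_ge0.
  by move/allP/(_ i (mem_index_enum _)); rewrite subr_eq0.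
exists T => //=; split=> //; apply/eqP; rewrite -(eqr_nat int) -zsum -natr1 -cT zT.
by apply/eqP; congr (_ + 1); apply: eq_bigr => i _; rewrite ffunE.
Qed.

Lemma rooted_trees_sum (z : {ffun I -> int}) :
  rooted_trees z -> \sum_i z i + 1 = #|vT|%:R.
Proof.
move=> [T [_ <-] <-]; rewrite -natr1 -sumr_const [in RHS]big_mkcond /=.
by congr (_ + 1); apply: eq_bigr => i _; rewrite ffunE; case: ifP.
Qed.

(** * Parent maps and their incidence vectors *)

Section Parent.
Variable o : vT.
Implicit Types (p : vT -> vT).

(** Entries are multiplicities: an undirected edge whose ends, both different from [o], are each
    other's parents gets the value 2. *)
Definition parent_vec p : {ffun I -> int} :=
  [ffun i => \sum_(v | v != o) (inc i (p v) v)%:R].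

Definition reroute p w u : vT -> vT := fun v => if v == w then u else p v.

Lemma parent_vec_reroute p w u i : w != o ->
  parent_vec (reroute p w u) i + (inc i (p w) w)%:R =
  parent_vec p i + (inc i u w)%:R.
Proof.
move=> wo; rewrite !ffunE (bigD1 w) //= [in RHS](bigD1 w) //= /reroute eqxx.
rewrite addrAC [RHS]addrAC addrC [RHS]addrC [X in _ + X]addrC; congr (_ + _).
by apply: eq_bigr => v /andP[_ /negbTE->].
Qed.

(** Each node but [o] contributes exactly one edge, which fixes the sum; iterating [p] down to [o]
    gives, read backwards, a path from [o] in the support. *)
Lemma parent_vec_tree p : (forall v, v != o -> p v != v) ->
  (forall v, exists k, iter k p v = o) -> rooted_trees (parent_vec p).
Proof.
have [_ inc1 _] := incP.
move=> pv pk; apply: rooted_support => [i||].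
- by rewrite ffunE sumr_ge0.
- under eq_bigr do rewrite ffunE.
  rewrite exchange_big /= (eq_bigr (fun=> 1)); last first.
    move=> v /pv /inc1[i Hi]; rewrite (bigD1 i) //= Hi eqxx big1 ?addr0// => j ji.
    by rewrite Hi (negbTE ji).
  by rewrite sumr_const natr1 cardC1 prednK //; apply/card_gt0P; exists o.
exists o => v; have [k] := pk v; elim: k v => [|k IH] v /=; first by move->.
rewrite -iterS iterSr => /IH conn.
have [->//|vo] := eqVneq v o.
apply: connect_trans conn _; apply: connect1; apply/existsP.
have [i Hi] := inc1 _ _ (pv _ vo); exists i; rewrite inE Hi eqxx andbT ffunE.
rewrite (bigD1 v) //= Hi eqxx gt_eqF // ltr_pwDl //.
by rewrite sumr_ge0.
Qed.

End Parent.

End Incidence.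

(** * Relaxations and hiding sets *)

Section Relaxation.
Import mathcomp.boot.fintype mathcomp.boot.finset.
Local Close Scope classical_set_scope.
Variables (R : realType) (vT I : finType) (inc : I -> rel vT).
Hypothesis incP : complete_incidence inc.
Implicit Types (S : {set vT}) (z : {ffun I -> int}).
Local Notation V := {ffun I -> R^o}.
Local Notation pt := (@lattice_pt R I).

Lemma dotp_lattice (c z : {ffun I -> int}) :
  dotp (pt c) (pt z) = (\sum_i c i * z i)%:~R.
Proof.
rewrite /dotp rmorph_sum; apply: eq_bigr => i _.
by rewrite !ffunE rmorphM.
Qed.

(** Negated, so that the demand for an edge entering [S] or [S'] becomes an upper bound of -1. *)
Definition cut S S' : {ffun I -> int} :=
  [ffun i => - (i \in entering inc S :|: entering inc S')%:R].

Lemma cutE S S' z :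
  \sum_i cut S S' i * z i = - \sum_(i in entering inc S :|: entering inc S') z i.
Proof.
rewrite -sumrN [RHS]big_mkcond /=; apply: eq_bigr => i _.
by rewrite ffunE; case: ifP => _; rewrite ?mulN1r // oppr0 mul0r.
Qed.

Lemma rooted_trees_cut S S' z : S != set0 -> S' != set0 -> [disjoint S & S'] ->
  rooted_trees inc z -> \sum_i cut S S' i * z i <= -1.
Proof.
move=> S0 S0' dis [T [rT _] <-]; rewrite cutE lerN2.
have [i iE iT] := rooted_entering rT S0 S0' dis.
rewrite (bigD1 i) //= ffunE iT lerDl; apply: sumr_ge0 => j _.
by rewrite ffunE.
Qed.

(** Cuts, nonnegativity, and the two halves of the equation for the sum. Other pairs of sets get the
    trivial [0 <= 0], which keeps the index type a plain product that is easy to count. *)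
Definition tree_ineq
    (j : {set vT} * {set vT} + I + bool) : {ffun I -> int} * int :=
  match j with
  | inl (inl (D, D')) =>
      if [&& D != set0, D' != set0 & [disjoint D & D']] then (cut D D', -1)
      else (0, 0)
  | inl (inr i) => ([ffun j => - (j == i)%:R], 0)
  | inr true => ([ffun => 1], #|vT|%:R - 1)
  | inr false => ([ffun => -1], 1 - #|vT|%:R)
  end.

Lemma tree_ineqP (v0 : vT) z : rooted_trees inc z <->
  forall j, \sum_i (tree_ineq j).1 i * z i <= (tree_ineq j).2.
Proof.
have oneE i : \sum_k ([ffun j => - (j == i)%:R] : {ffun I -> int}) k * z k = - z i.
  rewrite (bigD1 i) //= big1 ?addr0 => [|k ki]; rewrite ffunE ?eqxx ?mulN1r//.
  by rewrite (negbTE ki) oppr0 mul0r.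
have sumE : \sum_k ([ffun => 1] : {ffun I -> int}) k * z k = \sum_i z i.
  by apply: eq_bigr => i _; rewrite ffunE mul1r.
have sumNE : \sum_k ([ffun => -1] : {ffun I -> int}) k * z k = - \sum_i z i.
  by rewrite -sumrN; apply: eq_bigr => i _; rewrite ffunE mulN1r.
split=> [zX [[[S S']|i]|[]]|H] /=.
- case: ifP => [/and3P[S0 S0' dis]|_] /=; first exact: rooted_trees_cut zX.
  by rewrite big1 // => i _; rewrite ffunE mul0r.
- by rewrite oneE; case: zX => T _ <-; rewrite ffunE oppr_le0.
- by rewrite sumE -(rooted_trees_sum zX) addrK.
- by rewrite sumNE -(rooted_trees_sum zX) opprD addrCA subrr addr0.
have z0 i : 0 <= z i by have := H (inl (inr i)); rewrite /= oneE oppr_le0.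
apply: rooted_support => //.
  have /= := H (inr true); have /= := H (inr false); rewrite sumE sumNE => h1 h2.
  by apply/eqP; rewrite eq_le; apply/andP; split; lra.
apply: rooted_of_entering => // S S' S0 S0' dis.
have := H (inl (inl (S, S'))); rewrite /= S0 S0' dis /= cutE => le1.
suff /exists_inP[i iE zi] : [exists i in entering inc S :|: entering inc S', z i != 0].
  by exists i.
(* If all entering coordinates were 0, their sum could not reach 1. *)
apply: contraLR le1 => /exists_inPn z1; rewrite big1 // => i iE.
by apply/eqP/negPn/z1.
Qed.

(** The lattice points of the system are exactly the trees, and its solution set is convex. *)
Lemma rooted_trees_relaxation (v0 : vT) : exists2 P : classical_sets.set V,
  relaxation (rooted_trees inc) P &
  exists2 k, has_facets P k & (k <= #|{: {set vT} * {set vT} + I + bool}|)%N.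
Proof.
pose a j := pt (tree_ineq j).1; pose b j : R := (tree_ineq j).2%:~R.
exists ([set x | forall j, dotp (a j) x <= b j])%classic; last exact: has_facets_le.
split; first exact: polyhedron_fin.
have memP z : rooted_trees inc z <-> forall j, dotp (a j) (pt z) <= b j.
  by split=> [/(tree_ineqP v0) H j|H]; last apply/(tree_ineqP v0) => j;
     move: (H j); rewrite /a /b dotp_lattice ler_int.
apply/seteqP; split=> x [Hx [z _ zx]]; subst x; split; try by exists z.
  by apply: sub_conv_hull; exists z => //; apply/memP.
move=> j; apply: dotp_conv_hull Hx => _ [t /memP tX <-]; exact: tX.
Qed.

Lemma relaxation_sub (X : classical_sets.set {ffun I -> int}) P z :
  relaxation X P -> X z -> P (pt z).
Proof.
move=> [_ PX] Xz; suff [] : (P `&` @lattice R I)%classic (pt z) by [].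
by rewrite PX; split; [apply: sub_conv_hull; exists z|exists z].
Qed.

(** * Hiding sets from parent maps with a cycle *)

Section Hiding.
Variables (o : vT) (B : finType) (p : B -> vT -> vT) (S : B -> {set vT}).
Hypothesis p_neq : forall b v, v != o -> p b v != v.
Hypothesis S_neq0 : forall b, S b != set0.
Hypothesis o_notin : forall b, o \notin S b.
Hypothesis p_in : forall b v, v \in S b -> p b v \in S b.
Hypothesis p_out : forall b v, v \notin S b -> p b v = o.
Hypothesis p_cycle : forall b x y, x \in S b -> y \in S b ->
  exists k, iter k (p b) x = y.
Hypothesis p_exchange : forall b c, b != c -> exists y,
  [/\ y \in S b, y \in S c, p b y \notin S c & p c y \notin S b].

(** The cycle is broken at [w]: each node of [S b] runs along it to [w], then to [u], then to
    [o]. *)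
Lemma reroute_out_tree b w u : w \in S b -> u \notin S b ->
  rooted_trees inc (parent_vec inc o (reroute (p b) w u)).
Proof.
move=> wS uS; apply: parent_vec_tree => // v.
  rewrite /reroute; case: (v =P w) => [-> _|_]; last exact: p_neq.
  by apply: contraNneq uS => ->.
(* This includes [o], which is its own parent under [p b]. *)
have out x : x \notin S b -> iter 1 (reroute (p b) w u) x = o.
  move=> xS; rewrite /= /reroute; case: eqP => [xw|_]; last exact: p_out.
  by rewrite xw wS in xS.
have [vS|/out] := boolP (v \in S b); last by exists 1%N.
have [k] := p_cycle vS wS; elim: k v vS => [|k IH] v vS.
  move=> /= ->; exists 2%N; rewrite iterSr.
  by rewrite [reroute _ _ _ w]/reroute eqxx out.
rewrite iterSr => /(IH _ (p_in vS))[m Hm].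
have [->|vw] := eqVneq v w.
  by exists 2%N; rewrite iterSr [reroute _ _ _ w]/reroute eqxx out.
by exists m.+1; rewrite iterSr [reroute _ _ _ v]/reroute (negbTE vw).
Qed.

Lemma star_tree : rooted_trees inc (parent_vec inc o (fun=> o)).
Proof.
apply: parent_vec_tree => // [v|v]; first by rewrite eq_sym.
by exists 1%N.
Qed.

Lemma reroute_star_tree w u : w != o -> u != w ->
  rooted_trees inc (parent_vec inc o (reroute (fun=> o) w u)).
Proof.
move=> wo uw; apply: parent_vec_tree => // v.
  by rewrite /reroute; case: (v =P w) => [->|_ vo] //; rewrite eq_sym.
have out x : x != w -> iter 1 (reroute (fun=> o) w u) x = o.
  by rewrite /= /reroute => /negbTE->.
have [->|/out] := eqVneq v w; last by exists 1%N.
by exists 2%N; rewrite iterSr [reroute _ _ _ w]/reroute eqxx out.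
Qed.

Lemma in_neq_o b v : v \in S b -> v != o.
Proof. by apply: contraTneq => ->. Qed.

(** Away from [o], a node and its parent lie on the same side of [S b], so no edge of the vector
    crosses this cut. *)
Lemma parent_vec_cut b :
  \sum_i cut (S b) (~: S b) i * parent_vec inc o (p b) i = 0.
Proof.
have [_ _ inc2] := incP.
rewrite cutE big1 ?oppr0 // => i iE; rewrite ffunE big1 // => v vo.
have stab x : x != o -> (p b x \in S b) = (x \in S b).
  move=> xo; have [/p_in//|/p_out->] := boolP (x \in S b).
  exact/negbTE.
case iv : (inc i (p b v) v) => //; move: iE.
rewrite !inE => /orP[]; move=> /existsP[u /existsP[w /and3P[]]]; rewrite ?inE => uS wS.
  by move=> /(inc2 _ _ _ _ _ iv)[[? ?]|[? ?]]; subst; rewrite stab // in uS wS;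
     rewrite wS in uS.
by move=> /(inc2 _ _ _ _ _ iv)[[? ?]|[? ?]]; subst; rewrite stab // in uS wS;
   move: uS wS; case: (v \in S b).
Qed.

Lemma hiding_lower_bound (P : classical_sets.set V) k :
  relaxation (rooted_trees inc) P -> has_facets P k -> (#|B| <= k)%N.
Proof.
move=> relP; have [polyP PX] := relP.
have XP z : rooted_trees inc z -> P (pt z) by exact: relaxation_sub.
move=> Pk; apply: (hiding_has_facets (h := fun b => pt (parent_vec inc o (p b)))
  polyP Pk) => [|b|b Ph|b c bc].
- exists (pt (parent_vec inc o (fun=> o))); apply: XP; exact: star_tree.
- have /set0Pn[w wS] := S_neq0 b; have wo := in_neq_o wS.
  (* Exchanging the parents of [w] between [p b] and the star at [o] keeps the sum, so the hidden
     point is [q] minus the star plus [s], an affine combination of trees. *)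
  pose q := reroute (p b) w o; pose s := reroute (fun=> o) w (p b w).
  exists 3%N, (fun i : 'I_3 => if val i == 1%N then -1 else 1),
   (fun i : 'I_3 => pt (parent_vec inc o
      (if val i == 0%N then q else if val i == 1%N then (fun=> o) else s))).
  split.
  + move=> i; apply: XP; case: ifP => _; first exact: reroute_out_tree.
    case: ifP => _; first exact: star_tree.
    by apply: reroute_star_tree => //; exact: p_neq.
  + by rewrite !big_ord_recl big_ord0 /=; lra.
  + rewrite !big_ord_recl big_ord0 /= addr0 !scale1r scaleN1r.
    have H1 i := parent_vec_reroute inc (p b) o i wo.
    have H2 i := parent_vec_reroute inc (fun=> o) (p b w) i wo.
    move: H1 H2; rewrite -/q -/s.
    move: (parent_vec _ _ q) (parent_vec _ _ s) => x y.
    move: (parent_vec _ _ (p b)) (parent_vec _ _ (fun=> o)) => h t H1 H2.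
    apply/ffunP => i; rewrite !ffunE.
    have -> : h i = x i - t i + y i by have := H1 i; have := H2 i; lia.
    by rewrite rmorphD rmorphB addrA.
(* A lattice point of [P] lies in the hull of the trees, where the cut is at most -1; here it is
   0. *)
- have : conv_hull (pt @` rooted_trees inc)%classic (pt (parent_vec inc o (p b))).
    have : (P `&` @lattice R I)%classic (pt (parent_vec inc o (p b))).
      by split=> //; exists (parent_vec inc o (p b)).
    by rewrite PX => -[].
  have dis : [disjoint S b & ~: S b].
    by rewrite -setI_eq0 setICr.
  have S'0 : ~: S b != set0 by apply/set0Pn; exists o; rewrite inE o_notin.
  move=> /(dotp_conv_hull (a := pt (cut (S b) (~: S b))) (b := -1)).
  rewrite dotp_lattice parent_vec_cut => H.
  have : (0%:~R : R) <= -1.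
    apply: H => _ [z zX <-]; rewrite dotp_lattice -[-1](rmorphN1 (intr : int -> R)).
    by rewrite ler_int; exact: rooted_trees_cut.
  by rewrite ler0N1.
(* Exchanging the parents of [y] gives two trees with the same sum, hence the same midpoint. *)
- have [y [yb yc pbc pcb]] := p_exchange bc.
  have yo := in_neq_o yb.
  have Tb := XP _ (reroute_out_tree yb pcb).
  have Tc := XP _ (reroute_out_tree yc pbc).
  suff -> : 2^-1 *: pt (parent_vec inc o (p b)) + 2^-1 *: pt (parent_vec inc o (p c))
     = 2^-1 *: pt (parent_vec inc o (reroute (p b) y (p c y))) +
       2^-1 *: pt (parent_vec inc o (reroute (p c) y (p b y))).
    move: polyP Tb Tc => [m [a [d ->]]] /= Tb Tc j.
    by rewrite dotpD !dotpZ; have := Tb j; have := Tc j; lra.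
  have H1 i := parent_vec_reroute inc (p b) (p c y) i yo.
  have H2 i := parent_vec_reroute inc (p c) (p b y) i yo.
  rewrite -!scalerDr; congr (_ *: _); apply/ffunP => i; move: (H1 i) (H2 i).
  move: (parent_vec _ _ _) (parent_vec _ _ _) (parent_vec _ _ _)
    (parent_vec _ _ _) => f g f' g' E1 E2.
  by rewrite !ffunE -!rmorphD; congr (_ %:~R); lia.
Qed.

End Hiding.
End Relaxation.

(* The nodes below [2N + 2] form layers [{2i, 2i + 1}] for [i <= N].  A bit
   vector selects one node of each layer, always the node 1 in layer 0, and its
   parent map turns the selected nodes into a cycle and attaches all other nodes
   to the node 0. *)
Section Layers.
Import mathcomp.boot.fintype mathcomp.boot.finset.
Local Close Scope classical_set_scope.
Local Open Scope nat_scope.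
Variables (N n : nat).
Hypothesis N_gt0 : 0 < N.
Hypothesis Nn : N.*2.+2 <= n.
Implicit Types (t : N.-tuple bool) (v : 'I_n).

Let o : 'I_n := Ordinal (leq_trans (ltn0Sn N.*2.+1) Nn).

(** The leading [true] keeps node 0 off every cycle and provides a node shared by all cycles, needed
    when an exchange wraps around. *)
Definition layer_bit t (i : nat) : bool := nth true (true :: t) i.

Definition layer_node t (i : nat) : 'I_n := insubd o (layer_bit t i + i.*2).

Definition layer_set t : {set 'I_n} :=
  [set v : 'I_n | (v < N.*2.+2) && (odd v == layer_bit t v./2)].

Definition layer_parent t v : 'I_n :=
  if v \in layer_set t then
    layer_node t (if v./2 is i.+1 then i else N)
  else o.

Lemma val_layer_node t i : i <= N ->
  layer_node t i = layer_bit t i + i.*2 :> nat.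
Proof.
move=> iN; rewrite val_insubd ifT //; apply: leq_trans Nn.
by case: (layer_bit t i); rewrite ?add0n ?add1n !ltnS ?leqW // leq_double.
Qed.

Lemma layer_node_in t t' i : i <= N ->
  (layer_node t i \in layer_set t') = (layer_bit t i == layer_bit t' i).
Proof.
move=> iN; rewrite inE val_layer_node // half_bit_double oddD odd_double addbF oddb.
rewrite [X in X && _](_ : _ = true) //.
by case: (layer_bit t i); rewrite ?add0n ?add1n !ltnS ?leqW // leq_double.
Qed.

Lemma layer_node_in_self t i : i <= N -> layer_node t i \in layer_set t.
Proof. by move=> iN; rewrite layer_node_in. Qed.

Lemma layer_node_eq t t' i : layer_bit t i = layer_bit t' i ->
  layer_node t i = layer_node t' i.
Proof. by rewrite /layer_node => ->. Qed.

Lemma layer_setP t v : v \in layer_set t -> exists2 i, i <= N & v = layer_node t i.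
Proof.
rewrite inE => /andP[vN /eqP vb].
have iN : v./2 <= N by rewrite -[N]doubleK -ltnS -[X in X < _]/(v./2); lia.
exists v./2 => //; apply: val_inj; rewrite /= val_layer_node // -vb.
by rewrite odd_double_half.
Qed.

Lemma layer_parent0 t : layer_parent t (layer_node t 0) = layer_node t N.
Proof.
by rewrite /layer_parent layer_node_in_self // val_layer_node // half_bit_double.
Qed.

Lemma layer_parentS t i : i < N ->
  layer_parent t (layer_node t i.+1) = layer_node t i.
Proof.
move=> iN.
by rewrite /layer_parent layer_node_in_self // val_layer_node // half_bit_double.
Qed.

Lemma layer_node_neq t i j : i <= N -> j <= N -> i != j ->
  layer_node t i != layer_node t j.
Proof.
move=> iN jN; apply: contraNneq => /(congr1 (fun v : 'I_n => v./2)).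
by rewrite !val_layer_node // !half_bit_double => ->.
Qed.

Lemma layer_parent_neq t v : v != o -> layer_parent t v != v.
Proof.
move=> vo; have [/layer_setP[i iN ->]|vS] := boolP (v \in layer_set t); last first.
  by rewrite /layer_parent (negbTE vS) eq_sym.
case: i iN => [_|i iN]; first by rewrite layer_parent0 layer_node_neq // -lt0n.
by rewrite layer_parentS // layer_node_neq // ?(ltnW iN) // neq_ltn ltnSn.
Qed.

Lemma layer_set_neq0 t : layer_set t != set0.
Proof. by apply/set0Pn; exists (layer_node t 0); rewrite layer_node_in_self. Qed.

Lemma origin_notin_layer_set t : o \notin layer_set t.
Proof. by rewrite inE. Qed.

Lemma layer_parent_in t v : v \in layer_set t -> layer_parent t v \in layer_set t.
Proof.
move=> /layer_setP[[|i] iN ->]; first by rewrite layer_parent0 layer_node_in_self.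
by rewrite layer_parentS // layer_node_in_self // ltnW.
Qed.

Lemma layer_parent_out t v : v \notin layer_set t -> layer_parent t v = o.
Proof. by rewrite /layer_parent => /negbTE->. Qed.

Lemma layer_cycle t x y : x \in layer_set t -> y \in layer_set t ->
  exists k, iter k (layer_parent t) x = y.
Proof.
move=> /layer_setP[i iN ->] /layer_setP[j jN ->].
have down : iter i (layer_parent t) (layer_node t i) = layer_node t 0.
  elim: i iN => // i IH iN; rewrite iterSr layer_parentS //.
  by apply: IH; exact: ltnW.
have up d : d <= N -> iter d (layer_parent t) (layer_node t N) = layer_node t (N - d).
  elim: d => [|d IH] dN; first by rewrite subn0.
  rewrite iterS IH ?(ltnW dN) // -[N - d]prednK ?subn_gt0 // layer_parentS.
    by rewrite -subnS.
  by rewrite prednK ?subn_gt0 // leq_subr.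
(* [i] steps down to layer 0, one around to layer [N], and [N - j] down to layer [j]. *)
exists (N - j + i.+1); rewrite iterD iterS down layer_parent0 up ?leq_subr //.
by rewrite subKn.
Qed.

(** Let [i] be the last layer where the bits differ. They agree in layer [i.+1], or in layer 0 if
    [i = N]; the node chosen there is shared, and its two parents are the different nodes of layer
    [i]. *)
Lemma layer_exchange t t' : t != t' -> exists y,
  [/\ y \in layer_set t, y \in layer_set t', layer_parent t y \notin layer_set t' &
      layer_parent t' y \notin layer_set t].
Proof.
move=> tt'.
have [i0 /andP[i0N i0b]] : exists i, (i <= N) && (layer_bit t i != layer_bit t' i).
  have [i tti] : exists i : 'I_N, tnth t i != tnth t' i.
    apply/existsP; rewrite -negb_forall; apply: contra tt' => /forallP eqt.
    by apply/eqP/eq_from_tnth => i; apply/eqP.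
  by exists i.+1; rewrite ltn_ord /layer_bit /= -!tnth_nth.
pose Q i := (i <= N) && (layer_bit t i != layer_bit t' i).
have exQ : exists i, Q i by exists i0; rewrite /Q i0N.
have ubQ i : Q i -> i <= N by case/andP.
have [i /andP[iN ib] imax] := ex_maxnP exQ ubQ.
have nb u u' : layer_bit u i != layer_bit u' i -> layer_node u i \notin layer_set u'.
  by move=> uu; rewrite layer_node_in.
have ib' : layer_bit t' i != layer_bit t i by rewrite eq_sym.
have [iltN|Nlei] := ltnP i N.
  have eb : layer_bit t i.+1 = layer_bit t' i.+1.
    apply/eqP/negPn/negP => b; have := imax i.+1.
    by rewrite /Q iltN b ltnn => /(_ isT).
  exists (layer_node t i.+1); rewrite {2 4}(layer_node_eq eb).
  by rewrite !layer_parentS // !layer_node_in_self // !nb.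
have {Nlei iN} iN : i = N by apply/eqP; rewrite eqn_leq iN.
rewrite {}iN in nb ib ib'.
exists (layer_node t 0); have e0 : layer_bit t 0 = layer_bit t' 0 by [].
rewrite {2 4}(layer_node_eq e0).
by rewrite !layer_parent0 // !layer_node_in_self // !nb.
Qed.

Lemma rooted_trees_lower_bound (R : realType) (I : finType)
    (inc : I -> rel 'I_n) (P : classical_sets.set {ffun I -> R^o}) k :
  complete_incidence inc -> relaxation (rooted_trees inc) P -> has_facets P k ->
  2 ^ N <= k.
Proof.
move=> incP relP Pk.
have := hiding_lower_bound incP layer_parent_neq layer_set_neq0
  origin_notin_layer_set layer_parent_in layer_parent_out layer_cycle
  layer_exchange relP Pk.
by rewrite card_tuple card_bool.
Qed.

End Layers.

(** * Spanning trees and arborescences *)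

Section Instances.
Import mathcomp.boot.fintype mathcomp.boot.finset.
Local Close Scope classical_set_scope.
Local Open Scope nat_scope.
Variable n : nat.
Hypothesis n_gt0 : 0 < n.

Definition edge_inc (e : edgeT n) (u v : 'I_n) : bool :=
  val e == [set u; v]%SET.

Definition arc_inc (a : arcT n) (u v : 'I_n) : bool := val a == (u, v).

Lemma set2_eq (T : finType) (u v u' v' : T) : u != v ->
  [set u; v]%SET = [set u'; v']%SET -> (u' = u /\ v' = v) \/ (u' = v /\ v' = u).
Proof.
move=> uv E.
have : u' \in [set u; v]%SET by rewrite E set21.
have : v' \in [set u; v]%SET by rewrite E set22.
have : u \in [set u'; v']%SET by rewrite -E set21.
have : v \in [set u'; v']%SET by rewrite -E set22.
rewrite !in_set2 => /orP[]/eqP ? /orP[]/eqP ? /orP[]/eqP ? /orP[]/eqP ?; subst;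
  rewrite ?eqxx // in uv *; auto.
Qed.

Lemma edge_incidence : complete_incidence edge_inc.
Proof.
split=> [e u v /eqP ev|u v uv|e u v u' v'].
- have /eqP := valP e; rewrite /= ev cards2; by case: (u != v).
- have e2 : #|[set u; v]%SET| == 2 by rewrite cards2 uv.
  by exists (exist _ [set u; v]%SET e2) => e; rewrite -val_eqE.
- move=> /eqP ev /eqP ev'; apply: set2_eq; last by rewrite -ev ev'.
  have /eqP := valP e; rewrite /= ev cards2; by case: (u != v).
Qed.

Lemma arc_incidence : complete_incidence arc_inc.
Proof.
split=> [a u v /eqP av|u v uv|a u v u' v' /eqP av /eqP].
- by case: a av => [[x y] xy] /= [<- <-].
- by exists (exist _ (u, v) uv) => a; rewrite -val_eqE.
- by rewrite av => -[-> ->]; left.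
Qed.

Lemma adj_sym (T : {set edgeT n}) : symmetric (adj T).
Proof. by move=> u v; apply: eq_existsb => e; rewrite setUC. Qed.

Lemma connected_rooted (T : {set edgeT n}) :
  connected_graph T <-> rooted edge_inc T.
Proof.
split=> [cT|[r rT] u v]; first by exists (Ordinal n_gt0) => v; exact: cT.
apply: connect_trans (rT v).
by rewrite (sym_connect_sym (adj_sym T)); exact: rT.
Qed.

(** An edge of [T] outside a rooted subtree [T'] would close a cycle with the path in [T'] between
    its ends. *)
Lemma spanning_tree_card (T : {set edgeT n}) : spanning_tree T -> #|T|.+1 = n.
Proof.
move=> [/connected_rooted rT acT].
have [T' [T'T rT' cT']] := rooted_subtree edge_incidence rT.
rewrite card_ord in cT'.
suff -> : T = T' by [].
apply/eqP; rewrite eqEsubset T'T andbT; apply/subsetP => e eT.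
apply/negPn/negP => eT'.
have /cards2P[u [v [uv ev]]] := valP e.
have /connected_rooted/(_ u v)/connectP[s0 s0p] := rT'.
case/shortenP: s0p => s sp us _ vs.
apply: (acT (u :: s)).
  (* A path of one edge would be [e] itself, which is not in [T']; so the cycle has at least three
     nodes. *)
  case: s sp us vs => [|w [|w' s]] //=; first by move=> _ _ vu; rewrite vu eqxx in uv.
  rewrite andbT => /existsP[i /andP[iT' /eqP ivw]] _ vw; move: eT'.
  have -> : e = i by apply: val_inj; rewrite ev ivw vw.
  by rewrite iT'.
rewrite /ucycle us andbT /= rcons_path; apply/andP; split.
  by apply: sub_path sp => x y; exact: (@inc_adjS _ _ edge_inc).
by rewrite -vs adj_sym; apply/existsP; exists e; rewrite eT ev eqxx.
Qed.

(** Deleting an edge of a cycle leaves the graph rooted, as the rest of the cycle joins its ends,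
    but with too few edges. *)
Lemma rooted_spanning_tree (T : {set edgeT n}) :
  rooted edge_inc T -> #|T|.+1 = n -> spanning_tree T.
Proof.
move=> rT cT; split=> [|[|x [|y [|z s]]] // _]; first exact/connected_rooted.
move=> /andP[/= /andP[xy yzs] /andP[xn /andP[yn _]]].
have {}yzs : path (adj T) y (rcons (z :: s) x) by [].
have /existsP[e /andP[eT /eqP exy]] := xy.
pose T' := T :\ e.
have sub_adj u v : adj T u v -> [set u; v]%SET != [set x; y]%SET -> adj T' u v.
  move=> /existsP[i /andP[iT /eqP iuv]] uvxy; apply/existsP; exists i.
  rewrite !inE iT iuv eqxx andbT andbT; apply: contraNneq uvxy => ie.
  by rewrite -iuv ie exy.
have xy' : x != y by apply: contraNneq xn => ->; rewrite mem_head.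
(* The rest of the cycle avoids [x] before its last step, and that step does not start at [y]; so it
   never uses [e]. *)
have cyx : connect (adj T') y x.
  apply/connectP; exists (rcons (z :: s) x); last by rewrite last_rcons.
  move: yzs; rewrite !rcons_path.
  move=> /andP[ps lx]; apply/andP; split.
    have /(sub_in_path (P := [predC pred1 x])) sp :
      {in [predC pred1 x] &, subrel (adj T) (adj T')}.
      move=> u v; rewrite !inE => ux vx /sub_adj; apply.
      apply/eqP => E; have := set21 x y; rewrite -E in_set2.
      by rewrite eq_sym (negbTE ux) eq_sym (negbTE vx).
    apply: sp ps; apply/allP => u uys; rewrite inE /=.
    by apply: contraNneq xn => <-.
  apply: sub_adj lx _; apply/eqP => E.
  have := set22 x y; rewrite -E in_set2 eq_sym => /orP[/eqP ly|].
    by move: yn; rewrite -[X in X \notin _]ly /= mem_last.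
  by rewrite eq_sym (negbTE xy').
have sT' : symmetric (adj T') := adj_sym T'.
have conn : rooted edge_inc T'.
  move: rT => [r rT]; exists r => v.
  apply: (connect_sub _ (rT v)) => a b ab.
  have [E|/sub_adj] := eqVneq [set a; b]%SET [set x; y]%SET; last first.
    by move=> /(_ ab) ?; apply: connect1.
  case: (set2_eq xy' (esym E)) => -[-> ->] //.
  by rewrite (sym_connect_sym sT').
have := rooted_card edge_incidence conn.
by rewrite card_ord; move: cT; rewrite (cardsD1 e) eT add1n -/T' => cT le;
   have := leq_trans (eq_leq cT) le; rewrite ltnn.
Qed.

Lemma SPT_rooted_trees : SPT n = rooted_trees edge_inc.
Proof.
apply/seteqP; split=> _ [T tT <-]; exists T => //=.
  by rewrite card_ord spanning_tree_card //; case: tT => /connected_rooted.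
by move: tT => /= [rT]; rewrite card_ord; exact: rooted_spanning_tree.
Qed.

Lemma sum_indeg (T : {set arcT n}) : \sum_(v : 'I_n) indeg T v = #|T|.
Proof.
rewrite -sum1_card (partition_big (fun a : arcT n => (val a).2) predT) //=.
apply: eq_bigr => v _; rewrite /indeg -sum1_card.
by apply: eq_bigl => a; rewrite inE.
Qed.

(** The underlying graph is rooted with at most [n - 1] edges, hence a tree. The in-degrees add up
    to [n - 1] and are positive away from [r], so they are 1 there and 0 at [r]. *)
Lemma rooted_spanning_arborescence (T : {set arcT n}) :
  rooted arc_inc T -> #|T|.+1 = n -> spanning_arborescence T.
Proof.
move=> [r rT] cT.
pose edge_of (a : arcT n) : edgeT n :=
  exist _ [set (val a).1; (val a).2]%SET (introT eqP (etrans (cards2 _ _)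
    (congr1 (fun b : bool => b.+1) (valP a)))).
have sub_im : underlying T \subset edge_of @: T.
  apply/subsetP => e; rewrite inE => /existsP[a /andP[aT /eqP ea]].
  by apply/imsetP; exists a => //; apply: val_inj.
have cU : #|underlying T| <= #|T|.
  exact: leq_trans (subset_leq_card sub_im) (leq_imset_card _ _).
have rU : rooted edge_inc (underlying T).
  exists r => v; apply: (connect_sub _ (rT v)) => x y /existsP[a /andP[aT /eqP axy]].
  apply: connect1; apply/existsP; exists (edge_of a).
  rewrite inE /edge_inc /= axy eqxx andbT; apply/existsP; exists a.
  by rewrite aT axy eqxx.
split.
  apply: rooted_spanning_tree => //; apply/eqP; rewrite eqn_leq.
  have := rooted_card edge_incidence rU; rewrite card_ord => ->.
  rewrite andbT; exact: leq_trans (eq_leq cT).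
have deg1 v : v != r -> 0 < indeg T v.
  move=> vr; have := connect_exit (A := predC1 v) (rT v).
  rewrite !inE eqxx eq_sym vr => /(_ isT isT)[u [w]].
  rewrite !inE negbK => -[_ /eqP-> /existsP[a /andP[aT /eqP auv]]].
  by apply/card_gt0P; exists a; rewrite inE aT auv eqxx.
have := sum_indeg T; rewrite (bigD1 r) //=.
(* Splitting off one unit per node other than [r] cancels [n - 1] and leaves a sum of naturals equal
   to 0. *)
rewrite (eq_bigr (fun v => (indeg T v).-1 + 1)); last first.
  by move=> v /deg1 ?; rewrite addn1 prednK.
rewrite big_split /= sum1_card cardC1 card_ord (congr1 predn cT : #|T| = n.-1).
rewrite addnA => /eqP; rewrite -[X in _ == X]add0n eqn_add2r addn_eq0.
move=> /andP[/eqP r0 /eqP s0].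
exists r; split=> [//|v vr|v]; last exact: rT.
move/eqP: s0; rewrite sum_nat_eq0 => /forallP/(_ v); rewrite vr /= => /eqP.
by have := deg1 v vr; lia.
Qed.

Lemma spanning_arborescence_card (T : {set arcT n}) :
  spanning_arborescence T -> #|T|.+1 = n.
Proof.
move=> [_ [r [r0 d1 _]]]; rewrite -sum_indeg (bigD1 r) //= r0 add0n.
rewrite (eq_bigr (fun=> 1)) // sum1_card cardC1 card_ord prednK //.
Qed.

Lemma ARB_rooted_trees : ARB n = rooted_trees arc_inc.
Proof.
apply/seteqP; split=> _ [T tT <-]; exists T => //=.
  rewrite card_ord spanning_arborescence_card //.
  by case: tT => _ [r [_ _ rT]]; split=> //; exists r.
by move: tT => /= [rT]; rewrite card_ord; exact: rooted_spanning_arborescence.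
Qed.

Lemma card_edgeT : #|{: edgeT n}| <= 4 ^ n.
Proof.
rewrite card_sig; apply: leq_trans (max_card _) _.
by rewrite -cardsT -powersetT card_powerset cardsT card_ord (expnMn 2 2) leq_pmulr ?expn_gt0.
Qed.

Lemma card_arcT : #|{: arcT n}| <= 4 ^ n.
Proof.
rewrite card_sig; apply: leq_trans (max_card _) _.
rewrite card_prod card_ord -[4]/(2 * 2) expnMn.
by apply: leq_mul; apply: ltnW; apply: ltn_expl.
Qed.

End Instances.

(** * Exponential lower and upper bounds *)

Lemma two_pow_Theta_rc (R : realType) (I : nat -> finType)
    (inc : forall n, I n -> rel 'I_n) (X : forall n, set {ffun I n -> int}) :
  (forall n, complete_incidence (@inc n)) ->
  (forall n, (#|I n| <= 4 ^ n)%N) ->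
  (forall n, (0 < n)%N -> X n = rooted_trees (@inc n)) ->
  two_pow_Theta (fun n => rc R (X n)).
Proof.
move=> incP cardI XE; exists (4^-1), 4; split=> //.
near=> n.
have n6 : (6 <= n)%N by near: n; exact: nbhs_infty_ge.
have n0 : (0 < n)%N by exact: leq_trans n6.
rewrite XE //; apply/andP; split.
  apply: le_ereal_inf_tmp => _ [k [P [relP Pk]] <-]; rewrite lee_fin.
  (* The largest [N] whose layers fit into [n] nodes; for [n] at least 6 it is at least [n / 4]. *)
  pose N := n./2.-1.
  have N0 : (0 < N)%N by rewrite /N; lia.
  have Nn : (N.*2.+2 <= n)%N by rewrite /N; lia.
  have := rooted_trees_lower_bound N0 Nn (incP n) relP Pk.
  rewrite -(ler_nat R); apply: le_trans.
  rewrite natrX -powR_mulrn //; apply: ler_powR; first by rewrite ler1n.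
  have : (n <= 4 * N)%N by rewrite /N; lia.
  by rewrite -(ler_nat R) natrM; lra.
have [P relP [k Pk kJ]] := rooted_trees_relaxation R (incP n) (Ordinal n0).
apply: le_trans (ereal_inf_lbound _) _; first by exists k => //; exists P.
rewrite lee_fin -natrM powR_mulrn //.
rewrite -natrX ler_nat; apply: leq_trans kJ _.
rewrite !card_sum card_prod card_bool -!cardsT -!powersetT !card_powerset !cardsT card_ord.
rewrite -expnMn -[(2 * 2)%N]/4%N.
(* There are [4 ^ n] pairs of sets, at most [4 ^ n] coordinates and 2 further inequalities: at most
   [4 ^ n * 4 ^ n] together, as [4 ^ n] is at least 4. *)
rewrite expnM -[(2 ^ 4)%N]/(4 * 4)%N expnMn.
have := cardI n; have : (4 ^ 1 <= 4 ^ n)%N by rewrite leq_exp2l.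
by rewrite expn1; nia.
Unshelve. all: by end_near.
Qed.

Theorem theorem4 (R : realType) :
  two_pow_Theta (fun n : nat => rc R (ARB n)) /\
  two_pow_Theta (fun n : nat => rc R (SPT n)).
Proof.
split.
  exact: (two_pow_Theta_rc R arc_incidence card_arcT ARB_rooted_trees).
exact: (two_pow_Theta_rc R edge_incidence card_edgeT SPT_rooted_trees).
Qed.
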